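(* For every positive integer $k$ and every integer $n\geq 3k$, there exists an edge-colored complete graph $G$ on $n$ vertices with $c(G)=n+k-1$ (so that $m(G)+c(G)=\binom{n+1}{2}+k-1$) that contains exactly $k$ rainbow triangles.
   Context: Graphs are finite, simple and undirected. An edge-colored graph is a graph together with an arbitrary (not necessarily proper) assignment of a color to each edge. $m(G)$ denotes the number of edges of $G$, and $c(G)$ the number of distinct colors that actually appear on the edges of $G$. A subgraph is rainbow if all its edges have pairwise distinct colors; rainbow triangles are counted as distinct subgraphs (by their vertex sets). *)

(* Defs.v *)
From mathcomp Require Import all_boot.

Set Implicit Arguments.
Unset Strict Implicit.
Unset Printing Implicit Defensive.

(* An edge is the two-element set of its ends. [color] is total on {set T} for
   convenience: every definition below only reads its values on edges. *)
Record ecgraph (T : finType) (C : eqType) := ECGraph {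
  adj : rel T;
  adj_sym : symmetric adj;
  adj_irrefl : irreflexive adj;
  color : {set T} -> C
}.

Section EdgeColoredGraphs.

Variables (T : finType) (C : eqType) (G : ecgraph T C).

Definition edges : {set {set T}} :=
  [set [set x; y] | x in T, y in T & adj G x y].

Definition num_edges : nat := #|edges|.

Definition num_colors : nat := size (undup [seq color G e | e in edges]).

Definition complete : bool :=
  [forall x, forall y, (x != y) ==> adj G x y].

Definition rainbow (F : {set {set T}}) : bool :=
  dinjectiveb (color G) [in F].

Definition triangle (S : {set T}) : bool :=
  (#|S| == 3) && [forall x in S, forall y in S, (x != y) ==> adj G x y].

(* When S is a triangle, the edges contained in S are its three sides. *)
Definition rainbow_triangles : {set {set T}} :=
  [set S | triangle S && rainbow [set e in edges | e \subset S]].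

End EdgeColoredGraphs.

(* Main.v *)
Require Import Defs.
From mathcomp Require Import all_boot zify.

(** Split the vertices into [k] triples and [n - 3k] singletons, numbered in
    increasing order from [0] to [n - 2k - 1].  The [3k] edges inside the triples
    receive pairwise distinct colors, and an edge between two blocks is colored by
    the larger of the two block numbers, which is one of [1, ..., n - 2k - 1]; this
    gives [n + k - 1] colors.  The triples are rainbow.  A triangle that is not
    inside a block either has two vertices in one block, which send the same color
    to the third vertex, or meets three blocks, and the largest of the three block
    numbers colors two of its edges. *)

(* The two terms of the maximum are the block numbers of the vertices below
   and above [3 * k], respectively. *)
Definition block (k x : nat) : nat := maxn (x %/ 3) (x - 2 * k).

(* Inside a triple, the color of an edge is the third vertex; the three vertices
   of the triple [i] add up to [9 * i + 3]. *)
Definition pair_color (k x y : nat) : nat :=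
  if block k x == block k y then 9 * block k x + 3 - (x + y)
  else 3 * k + (maxn (block k x) (block k y)).-1.

Lemma pair_colorC (k : nat) : commutative (pair_color k).
Proof.
by move=> x y; rewrite /pair_color eq_sym (addnC x) maxnC; case: eqP => [->|].
Qed.

(** A description of [block] by linear inequalities, suited to [lia] in the case analyses below. *)
Lemma block_bounds (k x : nat) :
     x < 3 * k /\ 3 * block k x <= x <= 3 * block k x + 2
  \/ 3 * k <= x /\ x = block k x + 2 * k.
Proof. by rewrite /block; case: (ltnP x (3 * k)); [left | right]; lia. Qed.

Lemma block_triple (k i r : nat) : i < k -> r < 3 -> block k (3 * i + r) = i.
Proof. by move=> lti ltr; case: (block_bounds k (3 * i + r)); lia. Qed.

Lemma pair_color_lt (k n x y : nat) :
  3 * k <= n -> x < n -> y < n -> x != y -> pair_color k x y < n + k - 1.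
Proof.
move=> le_3k_n ltx lty xy; rewrite /pair_color.
by have:= block_bounds k x; have:= block_bounds k y; case: eqP; lia.
Qed.

Lemma pair_color_surj (k n c : nat) :
    0 < k -> 3 * k <= n -> c < n + k - 1 ->
  exists x y, [/\ x < n, y < n, x != y & pair_color k x y = c].
Proof.
move=> k_gt0 le_3k_n lt_c; have [lt_c3k | le_3kc] := ltnP c (3 * k).
  have lti : c %/ 3 < k by lia.
  (* A color [c] below [3 * k] is itself a vertex; the ends are the other two vertices of its
     triple. *)
  exists (3 * (c %/ 3) + (c %% 3 + 1) %% 3), (3 * (c %/ 3) + (c %% 3 + 2) %% 3).
  by rewrite /pair_color !block_triple ?ltn_pmod // eqxx; split; lia.
(* Any other [c] encodes the block number [m = c - 3 * k + 1], which is at least 1. Vertex 0, in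
   block 0, is joined to a vertex of block [m]: the first of a triple if [m < k], the singleton
   [m + 2 * k] otherwise. *)
have block0 : block k 0 = 0 by exact: (block_triple k 0 0).
have [lt_ck | le_kc] := ltnP (c - 3 * k + 1) k.
  exists 0, (3 * (c - 3 * k + 1) + 0).
  by rewrite /pair_color block0 block_triple //; split; try case: eqP; lia.
have block_c : block k (c - 3 * k + 1 + 2 * k) = c - 3 * k + 1.
  by case: (block_bounds k (c - 3 * k + 1 + 2 * k)); lia.
exists 0, (c - 3 * k + 1 + 2 * k).
by rewrite /pair_color block0 block_c //; split; try case: eqP; lia.
Qed.

(** Two distinct vertices share a block only in a triple, where the color names the vertex left out
    and so determines the pair. *)
Lemma pair_color_inj_block (k a b c d : nat) :
    a != b -> c != d ->
    block k a = block k b -> block k a = block k c -> block k a = block k d ->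
    pair_color k a b = pair_color k c d ->
  a = c /\ b = d \/ a = d /\ b = c.
Proof.
rewrite /pair_color => ab cd eab eac ead; rewrite -eab -eac -ead !eqxx.
have:= block_bounds k d; have:= block_bounds k c; have:= block_bounds k b.
by have:= block_bounds k a; rewrite -eab -eac -ead; lia.
Qed.

Lemma rainbow_same_block (k x y z : nat) :
    pair_color k x y != pair_color k x z ->
    pair_color k x y != pair_color k y z ->
    pair_color k x z != pair_color k y z ->
  block k x = block k y /\ block k x = block k z.
Proof.
rewrite /pair_color; move: (block k x) (block k y) (block k z) => a b c.
by do ![case: eqP]; lia.
Qed.

Section CompleteGraph.

Variables (n : nat) (f : nat -> nat -> nat).

(** [color] reads a set, not a pair; the maximum ranges over both orders of the ends of an edge,
    which agree when [f] is commutative. *)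
Definition set_color (e : {set 'I_n}) : nat :=
  \max_(x in e) \max_(y in e | y != x) f x y.

Lemma neq_sym : symmetric (fun x y : 'I_n => x != y).
Proof. by move=> x y; rewrite eq_sym. Qed.

Lemma neq_irrefl : irreflexive (fun x y : 'I_n => x != y).
Proof. by move=> x; rewrite eqxx. Qed.

Definition complete_ecgraph : ecgraph 'I_n nat :=
  ECGraph neq_sym neq_irrefl set_color.

Lemma set_color2 (x y : 'I_n) :
  commutative f -> x != y -> set_color [set x; y] = f x y.
Proof.
move=> fC xy; rewrite /set_color big_setU1 ?inE //= big_set1.
rewrite (big_pred1 y) => [|z /=]; last first.
  by rewrite !inE; have [->|] := eqVneq z x; rewrite ?(negPf xy) ?andbT ?andbF.
rewrite (big_pred1 x) => [|z /=]; last first.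
  rewrite !inE; have [->|] := eqVneq z y; last by rewrite orbF andbT.
  by rewrite eq_sym (negPf xy) andbF.
by rewrite (fC y) maxnn.
Qed.

Lemma edgesP (e : {set 'I_n}) :
  reflect (exists x y : 'I_n, x != y /\ e = [set x; y])
          (e \in edges complete_ecgraph).
Proof.
apply: (iffP imset2P) => [[x y _ /[!inE] /= xy ->]|[x [y [xy ->]]]].
  by exists x, y.
by exists x y; rewrite ?inE.
Qed.

Lemma num_edges_complete : num_edges complete_ecgraph = 'C(n, 2).
Proof.
rewrite -[in RHS](card_ord n) -card_draws; congr #|pred_of_set _|.
by apply/setP=> e; rewrite inE; apply/edgesP/cards2P => -[x [y]] [];
  exists x, y.
Qed.

Lemma triangle_complete (S : {set 'I_n}) :
  triangle complete_ecgraph S = (#|S| == 3).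
Proof.
rewrite /triangle andb_idr // => _.
by apply/forall_inP=> x _; apply/forall_inP=> y _; apply/implyP.
Qed.

End CompleteGraph.

Section Construction.

Variables (k n : nat) (k_gt0 : 0 < k) (le_3k_n : 3 * k <= n).

Let G := complete_ecgraph n (pair_color k).

Let color2 (x y : 'I_n) :
  x != y -> set_color n (pair_color k) [set x; y] = pair_color k x y.
Proof. exact/set_color2/pair_colorC. Qed.

Lemma num_colors_construction : num_colors G = n + k - 1.
Proof.
rewrite -[RHS](size_iota 0); apply/perm_size/uniq_perm.
- exact: undup_uniq.
- exact: iota_uniq.
move=> c; rewrite mem_undup mem_iota /= add0n; apply/imageP/idP.
  by move=> [_ /edgesP[x [y [xy ->]]] ->]; rewrite color2 //; apply: pair_color_lt.
move=> /(pair_color_surj _ _ _ k_gt0 le_3k_n)[x [y [ltx lty xy <-]]].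
have xy' : Ordinal ltx != Ordinal lty by [].
exists [set Ordinal ltx; Ordinal lty]; last by rewrite color2.
by apply/edgesP; exists (Ordinal ltx), (Ordinal lty).
Qed.

Definition triple (i : 'I_k) : {set 'I_n} := [set x : 'I_n | block k x == i].

Lemma triple_elements (i : 'I_k) :
  exists x y z : 'I_n,
    [/\ x = 3 * i :> nat, y = 3 * i + 1 :> nat, z = 3 * i + 2 :> nat
      & triple i = [set x; y; z]].
Proof.
have lti := ltn_ord i.
have [lt0 [lt1 lt2]] : 3 * i < n /\ 3 * i + 1 < n /\ 3 * i + 2 < n by lia.
exists (Ordinal lt0), (Ordinal lt1), (Ordinal lt2); split=> //.
by apply/setP=> x; rewrite !inE -!val_eqE /= /block; lia.
Qed.

Lemma card_triple (i : 'I_k) : #|triple i| = 3.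
Proof.
have [x [y [z [ex ey ez ->]]]] := triple_elements i.
by rewrite setUC !cardsU1 cards1 !inE -!val_eqE /= ex ey ez; lia.
Qed.

Lemma triple_inj : injective triple.
Proof.
move=> i j eq_ij; have [x [y [z [_ _ _ def_i]]]] := triple_elements i.
have xi : x \in triple i by rewrite def_i !inE eqxx.
have xj : x \in triple j by rewrite -eq_ij.
by apply/val_inj; move: xi xj; rewrite !inE /= => /eqP<- /eqP.
Qed.

Lemma rainbow_triple (i : 'I_k) :
  rainbow G [set e in edges G | e \subset triple i].
Proof.
apply/dinjectiveP=> e e' /setIdP[/edgesP[a [b [ab ->]]] sab].
move=> /setIdP[/edgesP[c [d [cd ->]]] scd]; rewrite /= !color2 //.
move: sab scd; rewrite !subUset !sub1set !inE.
move=> /andP[/eqP ea /eqP eb] /andP[/eqP ec /eqP ed] eq_color.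
have:= pair_color_inj_block k a b c d ab cd.
rewrite ea eb ec ed => /(_ erefl erefl erefl eq_color) [] [/val_inj-> /val_inj->] //.
exact: setUC.
Qed.

Lemma rainbow_triangle_triple (S : {set 'I_n}) :
    #|S| = 3 -> rainbow G [set e in edges G | e \subset S] ->
  exists i, S = triple i.
Proof.
move=> S3 /dinjectiveP inj_color.
have in_sides (a b : 'I_n) : a \in S -> b \in S -> a != b ->
    [set a; b] \in [set e in edges G | e \subset S].
  by move=> aS bS ab; rewrite inE subUset !sub1set aS bS !andbT; apply/edgesP;
    exists a, b.
(* Distinct sides have distinct colors, and an end of one side lying off the other shows that the
   two differ. *)
have side (a b c d : 'I_n) : a \in S -> b \in S -> a != b ->
    c \in S -> d \in S -> c != d ->
    a \notin [set c; d] -> pair_color k a b != pair_color k c d.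
  move=> aS bS ab cS dS cd; apply: contraNneq => eq_color.
  suffices <- : [set a; b] = [set c; d] by rewrite !inE eqxx.
  by apply: inj_color; rewrite /= ?color2 //; apply: in_sides.
have [x [y [z [defS xy xz yz]]]] : exists x y z : 'I_n,
    [/\ S = [set x; y; z], x != y, x != z & y != z].
  case: (cards_eqP S) S3 => -[|x [|y [|z []]]] //=.
  rewrite !inE !negb_or !andbT => /andP[/andP[xy xz] yz] _; exists x, y, z.
  by split=> //; apply/setP=> t; rewrite !inE orbA.
have [xS yS zS] : [/\ x \in S, y \in S & z \in S].
  by rewrite defS !inE !eqxx !orbT.
have [] := rainbow_same_block k x y z.
(* Here [y] is the end lying off the other side, so it has to come first. *)
- by rewrite (pair_colorC k x y) side // ?inE ?negb_or ?(eq_sym y x) ?xy ?yz.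
- by rewrite side // !inE negb_or xy xz.
- by rewrite side // !inE negb_or xy xz.
(* A block with two distinct vertices is no singleton, hence a triple. It contains [S] and has the
   same size. *)
move=> exy exz; have ltx : block k x < k.
  have := block_bounds k x; have := block_bounds k y.
  by move: xy; rewrite -exy -val_eqE /=; lia.
exists (Ordinal ltx); apply/eqP; rewrite eqEcard S3 card_triple leqnn andbT.
by rewrite defS !subUset !sub1set !inE /= -exy -exz eqxx.
Qed.

Lemma rainbow_triangles_construction :
  rainbow_triangles G = [set triple i | i : 'I_k].
Proof.
apply/setP=> S; rewrite inE triangle_complete; apply/andP/imsetP.
  by case=> /eqP S3 /(rainbow_triangle_triple _ S3)[i ->]; exists i.
by case=> i _ ->; rewrite card_triple rainbow_triple.
Qed.

End Construction.

Theorem mainTheorem5 (k n : nat) (k_gt0 : 0 < k) (le_3k_n : 3 * k <= n) :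
  exists G : ecgraph 'I_n nat,
    [/\ complete G,
        num_colors G = n + k - 1,
        num_edges G + num_colors G = 'C(n.+1, 2) + k - 1
      & #|rainbow_triangles G| = k].
Proof.
exists (complete_ecgraph n (pair_color k)); split.
- by apply/forallP=> x; apply/forallP=> y; apply/implyP.
- exact: num_colors_construction.
(* Pascal's rule splits the binomial coefficient of [n.+1] into that of [n] plus [n]. *)
- by rewrite num_colors_construction // num_edges_complete binS bin1; lia.
rewrite rainbow_triangles_construction // card_imset ?card_ord //.
exact: triple_inj.
Qed.
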